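(* Let $k$ be a field, let $d\geq 2$, and let $V_d$ be a $d$-dimensional $k$-vector space with a fixed basis. Define $det^{S^2}:V_d^{d(2d-1)}\to k$ by $det^{S^2}((v_{i,j})_{1\leq i<j\leq 2d})=\det\big(A_1((v_{i,j})_{1\leq i<j\leq 2d})\big)$. Then $det^{S^2}$ is a nontrivial (i.e. not identically zero) multilinear map with the property that $det^{S^2}((v_{i,j})_{1\leq i<j\leq 2d})=0$ whenever there exist $1\leq x<y<z\leq 2d$ such that $v_{x,y}=v_{x,z}=v_{y,z}$.
   Context: Let $\mathcal{B}_d=\{e_1,\dots,e_d\}$ be the fixed basis of $V_d$; vectors of $V_d$ are written as column vectors in $k^d$ with respect to it. An element of $V_d^{d(2d-1)}$ is a family $(v_{i,j})_{1\leq i<j\leq 2d}$ of vectors of $V_d$ indexed by the $d(2d-1)$ pairs $1\leq i<j\leq 2d$. Given such a family, for each $1\leq r\leq 2d$ let $\mathcal{E}_r$ be the vector equation in the scalar unknowns $(\lambda_{i,j})_{1\leq i<j\leq 2d}$: $$\sum_{s=1}^{r-1}(-1)^{s-1}\lambda_{s,r}v_{s,r}+\sum_{t=r+1}^{2d}(-1)^{t}\lambda_{r,t}v_{r,t}=0 .$$ Let $M_r$ be the $d\times d(2d-1)$ coefficient matrix of $\mathcal{E}_r$: its columns are indexed by the pairs $(i,j)$ with $1\le i<j\le 2d$, listed in the order $(1,2),(1,3),(2,3),(1,4),(2,4),(3,4),(1,5),\dots$ (ordered by $j$ first and then by $i$); the column indexed by $(s,r)$ with $s<r$ is $(-1)^{s-1}v_{s,r}$,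 the column indexed by $(r,t)$ with $t>r$ is $(-1)^t v_{r,t}$, and all other columns are $0$. Then $A_1((v_{i,j})_{1\leq i<j\leq 2d})$ is the square $d(2d-1)\times d(2d-1)$ matrix obtained by stacking $M_2,M_3,\dots,M_{2d}$ on top of each other in this order (i.e. the matrix of the system $\mathcal{E}_1,\dots,\mathcal{E}_{2d}$ after eliminating $\mathcal{E}_1$). *)

(* Defs.v *)
From HB Require Import structures.
From mathcomp Require Import all_boot all_order all_algebra.
From mathcomp Require Import zify.

Set Implicit Arguments.
Unset Strict Implicit.
Unset Printing Implicit Defensive.

Import GRing.Theory.
Local Open Scope ring_scope.

(* Indices are 0-based: the ordinal i stands for the index i + 1 in 1..2d. *)
Definition pairs (d : nat) :=
  {p : 'I_(2 * d) * 'I_(2 * d) | (p.1 < p.2)%N}.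

Definition mkpair (d : nat) (i j : 'I_(2 * d)) (ltij : (i < j)%N) : pairs d :=
  exist (fun p : 'I_(2 * d) * 'I_(2 * d) => (p.1 < p.2)%N) (i, j) ltij.

(* The outer loop is on j: (1,2), (1,3), (2,3), (1,4), (2,4), (3,4), ... *)
Definition pair_seq (d : nat) : seq (pairs d) :=
  pmap insub [seq (i, j) | j <- enum 'I_(2 * d), i <- enum 'I_(2 * d)].

Lemma size_pair_seq (d : nat) : size (pair_seq d) == (d * (2 * d - 1))%N.
Proof.
rewrite size_pmap_sub count_flatten -map_comp sumnE big_map big_enum /=.
have cnt (j : 'I_(2 * d)) :
    count (fun p : 'I_(2 * d) * 'I_(2 * d) => p.1 < p.2)%N
      [seq (i, j) | i <- enum 'I_(2 * d)] = j.
  rewrite count_map /= -[LHS](count_map val (fun i => i < j)%N) val_enum_ord.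
  by rewrite -size_filter (@filter_iota_ltn 0) ?size_iota // ltnW.
rewrite (eq_bigr (fun j : 'I_(2 * d) => val j)) => [|j _]; last exact: cnt.
by rewrite -(big_mkord xpredT id) bin2_sum bin2; apply/eqP; lia.
Qed.

Definition pair_tuple (d : nat) : (d * (2 * d - 1)).-tuple (pairs d) :=
  Tuple (size_pair_seq d).

Section DetS2.

Variables (k : fieldType) (d : nat) (V : vectType k) (e : d.-tuple V).

Definition coord_col (u : V) : 'cV[k]_d := \col_i coord e i u.

(* With 1-based indices, the r-th vector equation in the unknowns lambda is
     sum_(s < r) (-1)^(s-1) lambda_(s,r) v_(s,r)
       + sum_(t > r) (-1)^t lambda_(r,t) v_(r,t) = 0,
   and eqn_col v (r - 1) p is the coefficient of lambda_p; in 0-based indices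
   the signs become (-1)^s and (-1)^(t+1). *)
Definition eqn_col (v : pairs d -> V) (r : nat) (p : pairs d) : 'cV[k]_d :=
  let: (i, j) := val p in
  if r == j then (-1) ^+ i *: coord_col (v p)
  else if r == i then (-1) ^+ j.+1 *: coord_col (v p)
  else 0.

Definition eqn_mx (v : pairs d -> V) (r : nat) : 'M[k]_(d, d * (2 * d - 1)) :=
  \matrix_(l, c) eqn_col v r (tnth (pair_tuple d) c) l 0.

Lemma sum_rows : (\sum_(r < 2 * d - 1) d)%N = (d * (2 * d - 1))%N.
Proof. by rewrite sum_nat_const card_ord mulnC. Qed.

(* All the equations but the one of index 0 are stacked. *)
Definition A1 (v : pairs d -> V) : 'M[k]_(d * (2 * d - 1)) :=
  castmx (sum_rows, erefl) (\mxcol_(r < 2 * d - 1) eqn_mx v r.+1).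

Definition detS2 (v : pairs d -> V) : k := \det (A1 v).

End DetS2.

Definition multilinear (k : fieldType) (I : eqType) (V : lmodType k)
    (f : (I -> V) -> k) : Prop :=
  forall (v : I -> V) (i : I), scalar (fun x : V => f (dfwith v (i := i) x)).

(* Main.v *)
Require Import Defs.
From HB Require Import structures.
From mathcomp Require Import all_boot all_order all_algebra.
From mathcomp Require Import zify ring.

Set Implicit Arguments.
Unset Strict Implicit.
Unset Printing Implicit Defensive.

Import GRing.Theory.
Local Open Scope ring_scope.

(** The columns of [A1 v] are indexed by the edges [p = (i, j)] of the complete
    graph on [2 * d] vertices.  The column of [p] is the tensor product of
    [v p] with a vector supported on the two ends of [p], with coefficients
    [(-1) ^ j.+1] at [i] and [(-1) ^ i] at [j] ([inc]).  Multiplying the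
    coefficient at every vertex [r] by [(-1) ^ r] turns this vector into plus
    or minus the column of the oriented incidence matrix of the graph.  Three
    consequences give the theorem.

    Each column depends linearly on one of the vectors and on no other, so the
    determinant is multilinear.

    The three edges of a triangle form a cycle, hence their incidence columns
    are linearly dependent ([inc_triangle]); if they carry the same vector, the
    dependence passes to the columns of [A1 v].

    Finally, let every edge carry the basis vector [e_c] given by its colour
    [c] in an edge colouring with [d] colours.  A vector in the left kernel of
    [A1 v] amounts, after the change of signs, to one function on the vertices
    for each colour, vanishing at vertex 0 (whose equation is the eliminated
    one) and taking equal values at the ends of every edge of that colour.  If
    each colour class connects all the vertices, these functions are constant,
    hence zero, and [A1 v], being square, is invertible
    ([detS2_connected_coloring]).  Such a colouring is a decomposition of the
    complete graph into [d] spanning trees; the one used here consists of double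
    stars centred at the pairs of vertices [{2l, 2l + 1}]
    ([double_star_connected]). *)

Section Pairs.

Variable d : nat.

Lemma mem_pair_seq (p : pairs d) : p \in pair_seq d.
Proof.
rewrite mem_pmap_sub; apply/allpairsP; exists ((val p).2, (val p).1).
by rewrite !mem_enum; split=> //; case: (val p).
Qed.

Lemma pair_seq_uniq : uniq (pair_seq d).
Proof.
apply: pmap_sub_uniq; apply: allpairs_uniq; rewrite ?enum_uniq //.
by move=> [a b] [a' b'] _ _ /= [-> ->].
Qed.

Lemma tnth_pair_inj : injective (tnth (pair_tuple d)).
Proof. exact/tuple_uniqP/pair_seq_uniq. Qed.

Lemma tnth_pair_surj (p : pairs d) : exists c, tnth (pair_tuple d) c = p.
Proof. by have /tnthP[c ->] : p \in pair_tuple d := mem_pair_seq p; exists c. Qed.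

Lemma sum_tnth_pairs (V : nmodType) (F : pairs d -> V) :
  \sum_c F (tnth (pair_tuple d) c) = \sum_p F p.
Proof.
rewrite -(big_tuple _ _ (pair_tuple d) xpredT F) /=.
rewrite big_uniq ?pair_seq_uniq //; apply: eq_bigl => p.
exact: mem_pair_seq.
Qed.

End Pairs.

Section Columns.

Variables (k : fieldType) (d : nat).

(** The column of the edge [p] in the incidence matrix of the complete graph, up
    to the sign [(-1) ^ r] at each vertex [r] and a sign depending on [p]. *)
Definition inc (r : nat) (p : pairs d) : k :=
  (r == (val p).2 :> nat)%:R * (-1) ^+ (val p).1 +
  (r == (val p).1 :> nat)%:R * (-1) ^+ (val p).2.+1.

(** Up to an alternating sign, each edge is weighted by the sign of the opposite
    vertex, so that the two edges meeting at a vertex of the triangle cancel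
    there. *)
Lemma inc_triangle (x y z : 'I_(2 * d)) (hxy : (x < y)%N) (hyz : (y < z)%N) r :
  (-1) ^+ z * inc r (mkpair hxy) - (-1) ^+ y * inc r (mkpair (ltn_trans hxy hyz))
    + (-1) ^+ x * inc r (mkpair hyz) = 0.
Proof.
rewrite /inc /= !exprS !mulN1r !mulrN.
set a := (-1) ^+ x; set b := (-1) ^+ y; set c := (-1) ^+ z.
ring.
Qed.

Variables (V : vectType k) (e : d.-tuple V).

Lemma eqn_colE (v : pairs d -> V) r p :
  eqn_col e v r p = inc r p *: coord_col e (v p).
Proof.
rewrite /eqn_col /inc; have := valP p; case: (val p) => i j /= ltij.
case: eqP => [->|_]; last first.
  by case: eqP => _; rewrite mul0r add0r ?mul1r ?mul0r ?scale0r.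
by rewrite gtn_eqF // mul1r mul0r addr0.
Qed.

Lemma A1E (v : pairs d -> V) a b :
  let s := cast_ord (esym (sum_rows d)) a in
  let p := tnth (pair_tuple d) b in
  A1 e v a b = inc (tagnat.sig1 s).+1 p * coord e (tagnat.sig2 s) (v p).
Proof. by rewrite /A1 castmxE cast_ord_id !mxE eqn_colE !mxE. Qed.

Lemma detS2_multilinear : multilinear (detS2 e).
Proof.
move=> v p a u w; have [c pc] := tnth_pair_surj p.
have same x y : row' c (A1 e (dfwith v (i := p) x))^T
              = row' c (A1 e (dfwith v (i := p) y))^T.
  apply/matrixP=> i j; rewrite !mxE !A1E !dfwith_out //;
  by rewrite -pc (inj_eq (@tnth_pair_inj d)) neq_lift.
rewrite /detS2 -det_tr -[\det (A1 e (dfwith v u))]det_tr.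
rewrite -[\det (A1 e (dfwith v w))]det_tr -[X in _ = _ + X]mul1r.
apply: (@determinant_multilinear _ _ _ _ _ c); try exact: same.
apply/rowP=> j; rewrite !mxE !A1E /= pc !dfwith_in linearP /=.
by rewrite mulrDr mul1r mulrCA.
Qed.

(** A linear dependence between the incidence columns of edges that all carry
    the same vector is a right kernel vector of the whole matrix. *)
Lemma detS2_dependent (v : pairs d -> V) (g : pairs d -> k) (w : V) q :
    g q != 0 -> (forall p, g p != 0 -> v p = w) ->
    (forall r, \sum_p g p * inc r p = 0) -> detS2 e v = 0.
Proof.
move=> gq vw sum0; apply/eqP; rewrite /detS2 -det_tr; apply/det0P.
exists (\row_c g (tnth (pair_tuple d) c)).
  have [c qc] := tnth_pair_surj q.
  by apply: contraNneq gq => /rowP/(_ c); rewrite !mxE qc => ->.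
apply/rowP=> a; rewrite !mxE.
set s := cast_ord (esym (sum_rows d)) a.
pose F p := g p * (inc (tagnat.sig1 s).+1 p * coord e (tagnat.sig2 s) (v p)).
rewrite (eq_bigr (fun c => F (tnth (pair_tuple d) c))); last first.
  by move=> c _; rewrite !mxE A1E.
rewrite sum_tnth_pairs (eq_bigr (fun p => g p * inc (tagnat.sig1 s).+1 p
                                           * coord e (tagnat.sig2 s) w)).
  by rewrite -mulr_suml sum0 mul0r.
move=> p _; rewrite /F mulrA; have [->|/vw->//] := eqVneq (g p) 0.
by rewrite !mul0r.
Qed.

Lemma detS2_triangle (v : pairs d -> V) (x y z : 'I_(2 * d))
    (hxy : (x < y)%N) (hyz : (y < z)%N) :
  v (mkpair hxy) = v (mkpair (ltn_trans hxy hyz)) ->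
  v (mkpair (ltn_trans hxy hyz)) = v (mkpair hyz) ->
  detS2 e v = 0.
Proof.
set xy := mkpair hxy; set xz := mkpair _; set yz := mkpair hyz => exy exz.
pose g p : k := (p == xy)%:R * (-1) ^+ z - (p == xz)%:R * (-1) ^+ y
                + (p == yz)%:R * (-1) ^+ x.
have Nxy_xz : xy != xz by apply/eqP => -[/(congr1 val)/=]; lia.
have Nxy_yz : xy != yz by apply/eqP => -[/(congr1 val)/=]; lia.
apply: (@detS2_dependent v g (v xy) xy).
- rewrite /g eqxx (negPf Nxy_xz) (negPf Nxy_yz).
  by rewrite mul1r !mul0r subr0 addr0 signr_eq0.
- move=> p; rewrite /g; case: (p =P xy) => [->//|_].
  case: (p =P xz) => [->//|_]; case: (p =P yz) => [->|_]; first by rewrite exy.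
  by rewrite !mul0r subrr addr0 eqxx.
move=> r; rewrite -[RHS](inc_triangle hxy hyz r) -/xy -/xz -/yz.
have pick q a : \sum_p (p == q)%:R * a * inc r p = a * inc r q.
  rewrite (bigD1 q) //= eqxx mul1r big1 ?addr0 // => p /negPf->.
  by rewrite !mul0r.
under eq_bigr do rewrite /g mulrDl mulrBl.
by rewrite big_split sumrB /= !pick.
Qed.

(** Connectedness of the colour classes is expressed by the constancy of the
    functions that agree at the ends of every edge of the given colour, since
    this is how left kernel vectors appear. *)
Lemma detS2_connected_coloring (c : pairs d -> 'I_d) : free e ->
    (forall l (psi : 'I_(2 * d) -> k),
       (forall p, c p = l -> psi (val p).1 = psi (val p).2) ->
       forall r s, psi r = psi s) ->
  detS2 e (fun p => e`_(c p)) <> 0.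
Proof.
move=> fe conn /eqP/det0P[u /negP u0 uA]; apply: u0; apply/eqP.
pose v p := e`_(c p); pose U := castmx (erefl, esym (sum_rows d)) u.
have UA : U *m (\mxcol_(r < 2 * d - 1) eqn_mx e v r.+1) = 0.
  rewrite -uA /A1 /U; move: (sum_rows d) (\mxcol_r _) => E.
  by move: {uA U} u; case: _ / E => u' B; rewrite !castmx_id.
suff U0 s l : submxrow U s 0 l = 0.
  suff : U = 0.
    move/(congr1 (castmx (erefl, sum_rows d))).
    by rewrite /U castmxKV castmx_const.
  rewrite -[U]submxrowK -[RHS]submxrowK; apply: eq_mxrow => s.
  by apply/rowP=> l; rewrite U0 submxrow0 mxE.
(* The left kernel vector as a function on all the vertices; it vanishes at
   vertex 0, which has no row in the matrix. *)
pose phi (r : 'I_(2 * d)) := \sum_s submxrow U s 0 l * (s.+1 == r :> nat)%:R.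
have edge p : c p = l ->
    (-1) ^+ (val p).1 * phi (val p).2 = (-1) ^+ (val p).2 * phi (val p).1.
  move=> cp; have [b pb] := tnth_pair_surj p.
  have : (U *m (\mxcol_(r < 2 * d - 1) eqn_mx e v r.+1)) 0 b = 0.
    by rewrite UA mxE.
  rewrite -[X in X *m _]submxrowK mul_mxrow_mxcol summxE => sum0.
  apply/eqP; rewrite -subr_eq0 -{}sum0 /phi !mulr_sumr -sumrB.
  apply/eqP/eq_bigr => t _.
  rewrite [RHS]mxE (bigD1 l) //= big1 => [|m /negPf ml]; last first.
    by rewrite !mxE pb eqn_colE !mxE /v cp coord_free // eq_sym ml !mulr0.
  rewrite !mxE pb eqn_colE !mxE /v cp coord_free // eqxx mulr1 addr0 /inc.
  by rewrite exprS; ring.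
have const := conn l (fun r => (-1) ^+ r * phi r).
have {}const : forall r t : 'I_(2 * d), (-1) ^+ r * phi r = (-1) ^+ t * phi t.
  apply: const => p /edge.
  (* The change of signs at the vertices turns the relation of the two values at
     the ends of [p] into an equality. *)
  have := sqrr_sign k (val p).1; have := sqrr_sign k (val p).2.
  set x := (-1) ^+ (val p).1; set y := (-1) ^+ (val p).2 => y2 x2 E.
  transitivity (x * y * (y * phi (val p).1)).
    by rewrite -[LHS]mul1r -y2; ring.
  by rewrite -E -[RHS]mul1r -x2; ring.
have ltsd : (s.+1 < 2 * d)%N by have := ltn_ord s; lia.
pose r0 : 'I_(2 * d) := Ordinal (ltn_trans (ltn0Sn s) ltsd).
have phi0 : phi r0 = 0 by apply: big1 => t _; rewrite mulr0.
have := const (Ordinal ltsd) r0; rewrite phi0 mulr0 => /eqP.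
rewrite mulf_eq0 signr_eq0 /= => /eqP <-.
rewrite /phi (bigD1 s) //= eqxx mulr1 big1 ?addr0 // => t /negPf ts.
by rewrite eqSS (inj_eq val_inj) ts mulr0.
Qed.

End Columns.

Section DoubleStars.

Variable d : nat.

Lemma half_lt (i : 'I_(2 * d)) : (i./2 < d)%N.
Proof. by have := ltn_ord i; lia. Qed.

Definition half_ord (i : 'I_(2 * d)) : 'I_d := Ordinal (half_lt i).

(** The double star of colour [l] has the centres [2l] and [2l + 1], joined by
    an edge.  Of the four edges between the pairs [{2l, 2l + 1}] and
    [{2m, 2m + 1}] with [l < m], the two joining vertices of equal parity go to
    [l], where they attach [2m] and [2m + 1] to the centres of [l], and the
    other two go to [m], where they attach [2l] and [2l + 1] to the centres of
    [m]. *)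
Definition double_star (p : pairs d) : 'I_d :=
  let: (i, j) := val p in
  half_ord (if odd i == odd j then i else j).

(** Every vertex is joined by an edge of colour [l] to one of the two centres,
    which are joined to each other. *)
Lemma double_star_connected (T : Type) (l : 'I_d) (psi : 'I_(2 * d) -> T) :
    (forall p, double_star p = l -> psi (val p).1 = psi (val p).2) ->
  forall r s, psi r = psi s.
Proof.
move=> psiE.
have same (i j : 'I_(2 * d)) :
    (i < j)%N -> odd i = odd j -> i./2 = l -> psi i = psi j.
  move=> ltij ij il; apply: (psiE (mkpair ltij)).
  by apply: val_inj; rewrite /= ij eqxx.
have diff (i j : 'I_(2 * d)) :
    (i < j)%N -> odd i = ~~ odd j -> j./2 = l -> psi i = psi j.
  move=> ltij ij jl; apply: (psiE (mkpair ltij)).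
  by apply: val_inj; rewrite /= ij; case: (odd j).
have lt0 : (2 * l < 2 * d)%N by have := ltn_ord l; lia.
have lt1 : (2 * l + 1 < 2 * d)%N by have := ltn_ord l; lia.
pose a := Ordinal lt0; pose b := Ordinal lt1.
have ab : psi a = psi b by apply: diff => /=; lia.
suff toa r : psi r = psi a by move=> r s; rewrite !toa.
have [r_lt | r_ge] := ltnP r (2 * l).
  (* Below the centres, a vertex is joined to the centre of the other parity. *)
  case: (boolP (odd r)) => odr; last rewrite ab.
    by apply: diff => /=; lia.
  by apply: diff => /=; lia.
have [r_gt | r_le] := ltnP (2 * l + 1) r.
  (* Above them, it is joined to the centre of the same parity. *)
  case: (boolP (odd r)) => odr; first rewrite ab.
    by apply/esym/same => /=; lia.
  by apply/esym/same => /=; lia.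
have [ra | rb] : r = a \/ r = b.
  have [e|e] : (r : nat) = (2 * l)%N \/ (r : nat) = (2 * l + 1)%N by lia.
    by left; apply: val_inj.
  by right; apply: val_inj.
- by rewrite ra.
- by rewrite rb.
Qed.

End DoubleStars.

Theorem theorem3p6 (k : fieldType) (d : nat) (hd : (2 <= d)%N)
    (V : vectType k) (e : d.-tuple V) (he : basis_of {:V} e) :
  [/\ exists v : pairs d -> V, detS2 e v <> 0,
      multilinear (detS2 e)
    & forall (v : pairs d -> V) (x y z : 'I_(2 * d))
        (hxy : (x < y)%N) (hyz : (y < z)%N),
        v (mkpair hxy) = v (mkpair (ltn_trans hxy hyz)) ->
        v (mkpair (ltn_trans hxy hyz)) = v (mkpair hyz) ->
        detS2 e v = 0].
Proof.
split; last exact: detS2_triangle.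
- exists (fun p => e`_(double_star p)).
  apply: detS2_connected_coloring; first exact: basis_free he.
  exact: double_star_connected.
exact: detS2_multilinear.
Qed.
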